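(* Let $n\ge 1$, let $\widetilde D\subset\mathbb{R}^n$ be an arbitrary bounded domain, and let $a>0$ be an arbitrary (possibly arbitrarily small) number. Then every $g\in L^2(\widetilde D)$ can be approximated with arbitrary accuracy in $L^2(\widetilde D)$ by entire functions of exponential type of the form $$\widetilde f(\xi)=\int_{B_a}f(x)e^{i\xi\cdot x}\,dx,\qquad f\in L^2(B_a);$$ that is, for every $g\in L^2(\widetilde D)$ and every $\varepsilon>0$ there exists $f\in L^2(B_a)$ such that $\|g-\widetilde f\|_{L^2(\widetilde D)}<\varepsilon$.
   Context: $B_a:=\{x\in\mathbb{R}^n:|x|\le a\}$. Functions are complex-valued, and $\xi\cdot x=\sum_{k=1}^n\xi_kx_k$. *)

(* Defs.v *)
From HB Require Import structures.
From mathcomp Require Import all_boot all_order all_algebra.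
From mathcomp Require Import all_classical all_reals all_analysis.
From mathcomp Require Import measurable_realfun complex lra.

Set Implicit Arguments.
Unset Strict Implicit.
Unset Printing Implicit Defensive.

Import Order.TTheory GRing.Theory Num.Theory.
Import numFieldNormedType.Exports.
Import ComplexField.Normc.

Local Open Scope classical_set_scope.
Local Open Scope ring_scope.

(* R^n is 'rV[R]_n, with its library topology and with the product of the
   Borel sigma-algebras of the coordinates. *)
Section measurable_rV.
Variables (R : realType) (n : nat).

Definition rV_coord (i : 'I_n) (x : 'rV[R]_n) : R := x ord0 i.

Let rV_set0 : g_sigma_preimage rV_coord set0.
Proof. exact: sigma_algebra0. Qed.

Let rV_setC A : g_sigma_preimage rV_coord A -> g_sigma_preimage rV_coord (~` A).
Proof. exact: sigma_algebraC. Qed.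

Let rV_bigcup (F : (set 'rV[R]_n)^nat) :
  (forall i, g_sigma_preimage rV_coord (F i)) ->
  g_sigma_preimage rV_coord (\bigcup_i (F i)).
Proof. exact: sigma_algebra_bigcup. Qed.

HB.instance Definition _ := @isMeasurable.Build default_measure_display
  'rV[R]_n (g_sigma_preimage rV_coord) rV_set0 rV_setC rV_bigcup.

Lemma measurable_rV_coord (i : 'I_n) : measurable_fun setT (rV_coord i).
Proof.
move=> _ Y mY; rewrite setTI; apply: sub_sigma_algebra => /=.
rewrite -bigcup_seq/=; exists i => /=; first by rewrite mem_index_enum.
by exists Y => //; rewrite setTI.
Qed.

Lemma measurable_fun_rVP d (T : measurableType d) (f : T -> 'rV[R]_n) :
  (forall i, measurable_fun setT (rV_coord i \o f)) -> measurable_fun setT f.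
Proof.
move=> mf _ A; rewrite setTI.
suff : g_sigma_preimage rV_coord `<=` [set B | measurable (f @^-1` B)] by exact.
apply: smallest_sub.
  split => /=.
  - by rewrite preimage_set0.
  - by move=> B mB; rewrite setTD preimage_setC; exact: measurableC.
  - by move=> F mF; rewrite preimage_bigcup; exact: bigcup_measurable.
rewrite -bigcup_seq => B [i _ [C mC <-]] /=.
by rewrite setTI -comp_preimage -[X in measurable X]setTI; exact: mf.
Qed.

End measurable_rV.

Section lebesgue_rV_step.
Variables (R : realType) (n : nat).

Definition rV_cons (p : R * 'rV[R]_n) : 'rV[R]_n.+1 :=
  \row_i oapp (fun j => p.2 ord0 j) p.1 (unlift ord0 i).

Definition rV_uncons (x : 'rV[R]_n.+1) : R * 'rV[R]_n :=
  (x ord0 ord0, \row_j x ord0 (lift ord0 j)).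

Lemma rV_uncons_cons : cancel rV_uncons rV_cons.
Proof.
by move=> x; apply/rowP => i; rewrite mxE; case: unliftP => [j|] ->//=; rewrite mxE.
Qed.

Lemma rV_cons_uncons : cancel rV_cons rV_uncons.
Proof.
move=> [a x]; rewrite /rV_uncons mxE unlift_none/=; congr pair.
by apply/rowP => i; rewrite !mxE liftK.
Qed.

Lemma measurable_rV_cons : measurable_fun setT rV_cons.
Proof.
apply: measurable_fun_rVP => i.
rewrite /rV_coord /comp/=; under eq_fun do rewrite mxE.
case: (unlift _ _) => [j|]/=; last exact: measurable_fst.
exact: (measurableT_comp (measurable_rV_coord j) measurable_snd).
Qed.

Lemma measurable_rV_uncons : measurable_fun setT rV_uncons.
Proof.
apply: measurable_fun_pair; first exact: measurable_rV_coord.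
apply: measurable_fun_rVP => i.
rewrite /rV_coord /comp/=; under eq_fun do rewrite mxE.
exact: measurable_rV_coord.
Qed.

Variable mu : {sigma_finite_measure set 'rV[R]_n -> \bar R}.

Definition lebesgue_rV_step : set 'rV[R]_n.+1 -> \bar R :=
  pushforward (@lebesgue_measure R \x mu)%E rV_cons.

Let step0 : lebesgue_rV_step set0 = 0%E.
Proof. by rewrite /lebesgue_rV_step /pushforward preimage_set0 measure0. Qed.

Let step_ge0 A : (0 <= lebesgue_rV_step A)%E.
Proof. by rewrite /lebesgue_rV_step /pushforward; exact: measure_ge0. Qed.

Let step_sigma_additive : semi_sigma_additive lebesgue_rV_step.
Proof.
have mpre A : measurable A -> measurable (rV_cons @^-1` A).
  by move=> mA; rewrite -[X in measurable X]setTI; exact: measurable_rV_cons.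
move=> F mF tF mUF; rewrite /lebesgue_rV_step /pushforward preimage_bigcup.
apply: measure_semi_sigma_additive.
- by move=> k; exact: mpre.
- apply/trivIsetP => i j _ _ ij; rewrite -preimage_setI.
  by move/trivIsetP : tF => /(_ _ _ _ _ ij) ->//; rewrite preimage_set0.
- by rewrite -preimage_bigcup; exact: mpre.
Qed.

HB.instance Definition _ := isMeasure.Build _ _ _ lebesgue_rV_step
  step0 step_ge0 step_sigma_additive.

Lemma lebesgue_rV_step_sigma_finite : sigma_finite setT lebesgue_rV_step.
Proof.
have /sigma_finiteP[F [TF ndF Foo]] := sigma_finiteT (@lebesgue_measure R).
have /sigma_finiteP[G [TG ndG Goo]] := sigma_finiteT mu.
exists (fun k => rV_uncons @^-1` (F k `*` G k)).
  apply/esym/seteqP; split => // x _.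
  have [i _ Fi] : (\bigcup_i F i) (x ord0 ord0) by rewrite -TF.
  have [j _ Gj] : (\bigcup_i G i) (rV_uncons x).2 by rewrite -TG.
  exists (maxn i j) => //; split => /=.
    by move: Fi; exact/subsetPset/ndF/leq_maxl.
  by move: Gj; exact/subsetPset/ndG/leq_maxr.
move=> k; have [mF Fk] := Foo k; have [mG Gk] := Goo k; split.
  rewrite -[X in measurable X]setTI; apply: measurable_rV_uncons => //.
  exact: measurableX.
rewrite /lebesgue_rV_step /pushforward -comp_preimage.
rewrite (_ : _ \o _ = id); last by apply/funext => p; exact: rV_cons_uncons.
by rewrite preimage_id product_measure1E// lte_mul_pinfty// ge0_fin_numE.
Qed.

HB.instance Definition _ := Measure_isSigmaFinite.Build _ _ _ lebesgue_rV_step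
  lebesgue_rV_step_sigma_finite.

End lebesgue_rV_step.

Section lebesgue_rV0.
Variable R : realType.

Definition lebesgue_rV0 : set 'rV[R]_0 -> \bar R := @dirac _ 'rV[R]_0 0 R.

HB.instance Definition _ := Measure.on lebesgue_rV0.

Lemma lebesgue_rV0_sigma_finite : sigma_finite setT lebesgue_rV0.
Proof.
exists (fun=> setT); first by rewrite bigcup_const//; exists 0%N.
by move=> _; split => //; rewrite /lebesgue_rV0 diracT ltry.
Qed.

HB.instance Definition _ := Measure_isSigmaFinite.Build _ _ _ lebesgue_rV0
  lebesgue_rV0_sigma_finite.

End lebesgue_rV0.

Fixpoint lebesgue_rV (R : realType) (n : nat) :
    {sigma_finite_measure set 'rV[R]_n -> \bar R} :=
  match n with
  | 0 => @lebesgue_rV0 R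
  | m.+1 => lebesgue_rV_step (lebesgue_rV R m)
  end.

Lemma lebesgue_rV_box (R : realType) (n : nat) (A : 'I_n -> set R) :
  (forall i, measurable (A i)) ->
  lebesgue_rV R n [set x | forall i, A i (x ord0 i)] =
  (\prod_(i < n) lebesgue_measure (A i))%E.
Proof.
elim: n A => [|n ih] A mA.
  rewrite big_ord0 /= /lebesgue_rV0 diracE mem_set//= => -[]//.
rewrite big_ord_recl /= /lebesgue_rV_step /pushforward.
rewrite -(ih (fun i => A (lift ord0 i)))//.
set B := (X in lebesgue_rV R n X).
have mB : measurable B.
  rewrite (_ : B = \bigcap_i (@rV_coord R n i @^-1` A (lift ord0 i))).
    apply: fin_bigcap_measurable => // i _.
    by rewrite -[X in measurable X]setTI; exact: measurable_rV_coord.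
  by apply/seteqP; split=> x H i; [move=> _; exact: H|exact: (H i I)].
rewrite -product_measure1E//; last exact: mA.
congr (_ _); apply/seteqP; split=> -[a x] /=.
  move=> H; split; first by have := H ord0; rewrite mxE unlift_none.
  by move=> i; have := H (lift ord0 i); rewrite mxE liftK.
by move=> [Aa Ax] i; rewrite mxE; case: unliftP => [j|] ->/=.
Qed.

Lemma open_measurable_rV (R : realType) (n : nat) (A : set 'rV[R]_n) :
  open A -> measurable A.
Proof.
move=> oA.
pose box (q : {ffun 'I_n -> rat * rat}) : set 'rV[R]_n :=
  \bigcap_(i in [set: 'I_n])
    (@rV_coord R n i @^-1` `](ratr (q i).1), (ratr (q i).2)[%classic).
have mbox q : measurable (box q).
  apply: fin_bigcap_measurable => // i _.
  by rewrite -[X in measurable X]setTI; exact: measurable_rV_coord.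
have -> : A = \bigcup_(q in [set q | box q `<=` A]) box q.
  apply/seteqP; split=> [x Ax|x [q]]; last exact.
  have /nbhs_ballP[e /= e0 xeA] := open_nbhs_nbhs (conj oA Ax).
  have lbx i : exists q : rat * rat,
      (x ord0 i - e < ratr q.1 < x ord0 i) && (x ord0 i < ratr q.2 < x ord0 i + e).
    have [p] : exists p, ratr p \in `](x ord0 i - e), (x ord0 i)[.
      by apply: rat_in_itvoo; rewrite ltrBlDr ltrDl.
    rewrite in_itv/= => px.
    have [q] : exists q, ratr q \in `](x ord0 i), (x ord0 i + e)[.
      by apply: rat_in_itvoo; rewrite ltrDl.
    rewrite in_itv/= => xq; exists (p, q); exact/andP.
  have [q xq] := choice lbx.
  exists [ffun i => q i].
    move=> y yq; apply: xeA; split => // i j; rewrite ord1.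
    have := yq j I; rewrite /= in_itv/= ffunE /rV_coord => /andP[? ?].
    have /andP[/andP[? ?] /andP[? ?]] := xq j.
    suff : `|x ord0 j - y ord0 j| < e by [].
    rewrite ltr_norml; lra.
  move=> i _; rewrite /= in_itv/= ffunE /rV_coord.
  by have /andP[/andP[_ ->] /andP[-> _]] := xq i.
rewrite bigcup_mkcond; apply: countable_bigcupT_measurable => // q.
by case: ifP.
Qed.

Section L2_fourier.
Local Open Scope complex_scope.
Variables (R : realType) (n : nat).
Local Notation mu := (lebesgue_rV R n).
Implicit Types (D : set 'rV[R]_n) (F : 'rV[R]_n -> R[i]).

Definition domain D := [/\ open D, connected D & D !=set0].

Definition dotv (x y : 'rV[R]_n) : R := \sum_(k < n) x ord0 k * y ord0 k.

(* The library norm of 'rV[R]_n is the sup norm. *)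
Definition enorm (x : 'rV[R]_n) : R := Num.sqrt (dotv x x).

Definition cball0 (a : R) : set 'rV[R]_n := [set x | enorm x <= a].

(* The function is extended by 0 outside D and the norm is taken over R^n. *)
Definition L2norm D F : \bar R :=
  ('N[mu]_(2%:E) [(fun x => (normc (F x))%:E) \_ D])%E.

(* F is a Borel representative of a class of L^2(D); its values outside D are
   irrelevant.  measurable_fun D is vacuous when D is not measurable; see
   open_measurable_rV and measurable_cball0 for the sets used here. *)
Definition L2 D F : Prop :=
  [/\ measurable_fun D (fun x => complex.Re (F x)),
      measurable_fun D (fun x => complex.Im (F x))
    & (L2norm D F < +oo)%E].

Definition cintegral D F : R[i] :=
  (\int[mu]_(x in D) complex.Re (F x)) +i* (\int[mu]_(x in D) complex.Im (F x)).

(* e^{it} *)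
Definition expi (t : R) : R[i] := cos t +i* sin t.

Definition fourier_ball (a : R) F (xi : 'rV[R]_n) : R[i] :=
  cintegral (cball0 a) (fun x => F x * expi (dotv xi x)).

Lemma measurable_cball0 (a : R) : measurable (cball0 a).
Proof.
have mdot : measurable_fun setT (fun x : 'rV[R]_n => dotv x x).
  apply: measurable_sum => i.
  by apply: measurable_funM; exact: measurable_rV_coord.
have menorm : measurable_fun setT enorm.
  have msqrt : measurable_fun setT (@Num.sqrt R).
    by apply: continuous_measurable_fun; apply: sqrt_continuous.
  exact: (measurableT_comp msqrt mdot).
rewrite (_ : cball0 a = setT `&` enorm @^-1` `]-oo, a]); first exact: menorm.
by apply/seteqP; split=> x; rewrite /cball0/= in_itv/= => // -[].
Qed.

End L2_fourier.

(* Main.v *)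
(** A finite combination of exponentials [e^{i xi.y}], [|y| < a], is a uniform
    limit on the bounded set [D] of functions [fourier_ball a f]: take for [f]
    the same combination of normalised indicators of small cubes centred at the
    points [y].  Call a function of low frequency if, for every [b > 0], it is
    a uniform limit on [D] of such combinations with [|y| <= b].  Frequencies
    add up under multiplication, so these functions form an algebra, and it
    contains the coordinates since [sin (h xi_i) / h] tends to [xi_i] as [h]
    tends to 0; hence it contains the polynomials.  Polynomials taking values
    in [0, 1] on [D] converge pointwise on [D] to the indicators of half-spaces,
    so Dynkin's theorem and dominated convergence put the indicators of all
    Borel sets in the [L^2(D)]-closure of the algebra, which is therefore all of
    [L^2(D)]. *)

Require Import Defs.
From mathcomp Require Import all_boot all_order all_algebra.
From mathcomp Require Import all_classical all_reals all_analysis.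
From mathcomp Require Import measurable_realfun complex lra ring.
Import Order.TTheory GRing.Theory Num.Theory.
Import numFieldNormedType.Exports.
Import ComplexField.Normc.

Set Implicit Arguments.
Unset Strict Implicit.
Unset Printing Implicit Defensive.

Local Open Scope classical_set_scope.
Local Open Scope ring_scope.

(** * Density of an algebra of functions in L^2 *)

Section L2_density.
Import HBNNSimple.
Context d (T : measurableType d) (R : realType).
Variables (mu : {measure set T -> \bar R}) (D : set T).
Hypotheses (mD : measurable D) (Dfin : (mu D < +oo)%E).

Implicit Types u v w p q : T -> R.

(** The square of the L^2 distance, without a root: Minkowski's inequality is then replaced by
    [(s + t)^2 <= 2 s^2 + 2 t^2], at the price of factors 2. *)
Definition sqr_dist (u v : T -> R) : \bar R :=
  (\int[mu]_(x in D) ((u x - v x) ^+ 2)%:E)%E.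

Lemma sqr_dist_measurable u v : measurable_fun D u -> measurable_fun D v ->
  measurable_fun D (fun x => ((u x - v x) ^+ 2)%:E).
Proof.
by move=> meu mv; apply/measurable_EFinP/measurable_funX/measurable_funB.
Qed.

Lemma sqr_distD u v p q :
  measurable_fun D u -> measurable_fun D v ->
  measurable_fun D p -> measurable_fun D q ->
  (sqr_dist (fun x => u x + v x)%R (fun x => p x + q x)%R <=
   2%:E * sqr_dist u p + 2%:E * sqr_dist v q)%E.
Proof.
move=> meu mv mp mq; rewrite /sqr_dist.
have m1 := sqr_dist_measurable meu mp.
have m2 := sqr_dist_measurable mv mq.
have sqr0 (f g : T -> R) x : D x -> (0 <= ((f x - g x) ^+ 2)%:E)%E.
  by move=> _; rewrite lee_fin sqr_ge0.
rewrite -!ge0_integralZl//; try exact: sqr0.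
rewrite -ge0_integralD//; last 4 first.
- by move=> x Dx; rewrite mule_ge0// sqr0.
- exact: emeasurable_funM.
- by move=> x Dx; rewrite mule_ge0// sqr0.
- exact: emeasurable_funM.
apply: ge0_le_integral => //.
- by move=> x _; rewrite lee_fin sqr_ge0.
- by apply: sqr_dist_measurable; exact: measurable_funD.
- by apply: emeasurable_funD; exact: emeasurable_funM.
- move=> x _; rewrite -!EFinM -EFinD lee_fin.
  by have := sqr_ge0 ((u x - p x) - (v x - q x)); rewrite !expr2; nra.
Qed.

Lemma sqr_dist_trans u v w :
  measurable_fun D u -> measurable_fun D v -> measurable_fun D w ->
  (sqr_dist u w <= 2%:E * sqr_dist u v + 2%:E * sqr_dist v w)%E.
Proof.
move=> meu mv mw; apply: le_trans (sqr_distD meu mv mv mw).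
rewrite /sqr_dist le_eqVlt; apply/orP; left; apply/eqP; apply: eq_integral => x _.
by congr (_ ^+ 2)%:E; ring.
Qed.

Lemma sqr_distZ c u v : measurable_fun D u -> measurable_fun D v ->
  sqr_dist (fun x => c * u x) (fun x => c * v x) =
  ((c ^+ 2)%:E * sqr_dist u v)%E.
Proof.
move=> meu mv; rewrite /sqr_dist -ge0_integralZl//; last 3 first.
- exact: sqr_dist_measurable.
- by move=> x _; rewrite lee_fin sqr_ge0.
- by rewrite lee_fin sqr_ge0.
by apply: eq_integral => x _; rewrite -EFinM -mulrBr exprMn.
Qed.

(** Dominated convergence applied to [(u k - v)^2], with the integrable majorant [w^2]. *)
Lemma sqr_dist_dominated (u : (T -> R)^nat) (v w : T -> R) :
  (forall k, measurable_fun D (u k)) -> measurable_fun D v ->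
  measurable_fun D w -> (\int[mu]_(x in D) (w x ^+ 2)%:E < +oo)%E ->
  (forall k x, D x -> `|u k x - v x| <= w x) ->
  (forall x, D x -> u ^~ x @ \oo --> v x) ->
  forall (e : R), 0 < e -> exists k, (sqr_dist (u k) v < e%:E)%E.
Proof.
move=> meu mv mw wfin uw uv e e0.
have [] := @dominated_convergence _ _ _ mu D mD
  (fun k x => ((u k x - v x) ^+ 2)%:E) (cst 0%E) (fun x => (w x ^+ 2)%:E).
- by move=> k; exact: sqr_dist_measurable.
- exact: measurable_cst.
- apply: aeW => x Dx; apply: cvg_EFin; first exact: nearW.
  rewrite (_ : 0 = (v x - v x) * (v x - v x) :> R); last by rewrite subrr mulr0.
  under eq_fun do rewrite /= expr2.
  by apply: cvgM; apply: cvgB; (exact: uv || exact: cvg_cst).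
- apply/integrableP; split; first exact/measurable_EFinP/measurable_funX.
  rewrite (eq_integral (fun x => (w x ^+ 2)%:E))// => x _.
  by rewrite /= ger0_norm// sqr_ge0.
- apply: aeW => x k Dx; rewrite /= lee_fin ger0_norm ?sqr_ge0//.
  by rewrite -[leLHS]real_normK ?num_real// lerXn2r ?nnegrE ?uw ?(le_trans _ (uw k x Dx)).
move=> _ _; rewrite integral0 => /fine_cvgP[ffin].
move=> /cvgr0_norm_lt/(_ e e0) fe.
(* Finiteness is recorded together with smallness, because [fine] maps an infinite value to 0. *)
have [k [kfin ke]] : exists k, sqr_dist (u k) v \is a fin_num /\
    `|fine (sqr_dist (u k) v)| < e.
  near \oo => k; exists k; split; near: k; [exact: ffin|exact: fe].
by exists k; rewrite -(fineK kfin) lte_fin (le_lt_trans (ler_norm _)).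
Unshelve. all: by end_near. Qed.

(** * The L^2(D)-closure of an algebra [V] of functions *)

Variable V : set (T -> R).
Hypothesis Vm : forall p, V p -> measurable_fun D p.
Hypothesis V1 : V (cst 1).
Hypothesis VD : forall p q, V p -> V q -> V (fun x => p x + q x).
Hypothesis VM : forall p q, V p -> V q -> V (fun x => p x * q x).
Hypothesis VZ : forall c p, V p -> V (fun x => c * p x).

Definition L2adherent u := measurable_fun D u /\
  forall (e : R), 0 < e -> exists2 p, V p & (sqr_dist u p < e%:E)%E.

Lemma L2adherent_mem p : V p -> L2adherent p.
Proof.
move=> Vp; split=> [|e e0]; first exact: Vm.
exists p => //; rewrite /sqr_dist (eq_integral (cst 0%E)) ?integral0 ?lte_fin//.
by move=> x _; rewrite subrr expr0n.
Qed.

Lemma L2adherent_scale c u : L2adherent u -> L2adherent (fun x => c * u x).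
Proof.
move=> [meu Vu]; split=> [|e e0]; first exact: measurable_funM.
(* The summand 1 keeps the divisor positive when [c = 0]. *)
have c0 : 0 < c ^+ 2 + 1 by rewrite ltr_wpDl// sqr_ge0.
have [p Vp up] := Vu (e / (c ^+ 2 + 1)) (divr_gt0 e0 c0).
exists (fun x => c * p x); first exact: VZ.
rewrite sqr_distZ//; last exact: Vm.
apply: (@le_lt_trans _ _ ((c ^+ 2 + 1)%:E * sqr_dist u p)%E).
  apply: lee_wpmul2r; last by rewrite lee_fin lerDl.
  by apply: integral_ge0 => x _; rewrite lee_fin sqr_ge0.
by rewrite -lte_pdivlMl// -EFinM mulrC.
Qed.

Lemma L2adherentD u v : L2adherent u -> L2adherent v ->
  L2adherent (fun x => u x + v x).
Proof.
move=> [meu Vu] [mv Vv]; split=> [|e e0]; first exact: measurable_funD.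
(* [sqr_distD] doubles both errors, hence a quarter of [e] for each. *)
have e4 : 0 < e / 4 by rewrite divr_gt0.
have [p Vp up] := Vu _ e4; have [q Vq vq] := Vv _ e4.
exists (fun x => p x + q x); first exact: VD.
apply: (le_lt_trans (sqr_distD meu mv (Vm Vp) (Vm Vq))).
have -> : e%:E = (2%:E * (e / 4)%:E + 2%:E * (e / 4)%:E)%E.
  by rewrite -!EFinM -EFinD; congr (_%:E); field.
by rewrite lteD// lte_pmul2l// lte_fin.
Qed.

Lemma L2adherentB u v : L2adherent u -> L2adherent v ->
  L2adherent (fun x => u x - v x).
Proof.
move=> Vu Vv; rewrite (_ : (fun x => _) = (fun x => u x + (-1) * v x)).
  by apply: L2adherentD => //; exact: L2adherent_scale.
by apply/funext => x; rewrite mulN1r.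
Qed.

(** An index [k] with [u k] close to [v] is fixed first; an element of [V] close to [u k] is then
    close to [v] by [sqr_dist_trans]. *)
Lemma L2adherent_dominated (u : (T -> R)^nat) (v w : T -> R) :
  (forall k, L2adherent (u k)) -> measurable_fun D v ->
  measurable_fun D w -> (\int[mu]_(x in D) (w x ^+ 2)%:E < +oo)%E ->
  (forall k x, D x -> `|u k x - v x| <= w x) ->
  (forall x, D x -> u ^~ x @ \oo --> v x) -> L2adherent v.
Proof.
move=> Vu mv mw wfin uw uv; split=> // e e0.
have e4 : 0 < e / 4 by rewrite divr_gt0.
have meu k : measurable_fun D (u k) by have [] := Vu k.
have [k uk] := sqr_dist_dominated meu mv mw wfin uw uv e4.
have [_ /(_ _ e4)[p Vp up]] := Vu k.
exists p => //; apply: le_lt_trans (sqr_dist_trans mv (meu k) (Vm Vp)) _.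
have -> : e%:E = (2%:E * (e / 4)%:E + 2%:E * (e / 4)%:E)%E.
  by rewrite -!EFinM -EFinD; congr (_%:E); field.
rewrite lteD// lte_pmul2l// ?lte_fin//.
apply: le_lt_trans uk; rewrite /sqr_dist le_eqVlt; apply/orP; left; apply/eqP.
by apply: eq_integral => x _; congr (_%:E); ring.
Qed.

(** The bounds 0 and 1 survive products, which makes the reachable sets a pi-system, and they allow
    domination by the constant 1, square-integrable since [mu D] is finite. *)
Definition pointwise_reachable (A : set T) := exists2 p : (T -> R)^nat,
  (forall k, V (p k) /\ forall x, D x -> 0 <= p k x <= 1) &
  forall x, D x -> p ^~ x @ \oo --> (\1_A x : R).

Lemma pointwise_reachableI : setI_closed pointwise_reachable.
Proof.
move=> A B [p pV pA] [q qV qB]; exists (fun k x => p k x * q k x).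
  move=> k; have [Vp p01] := pV k; have [Vq q01] := qV k; split; first exact: VM.
  move=> x Dx; have /andP[? ?] := p01 _ Dx; have /andP[? ?] := q01 _ Dx.
  by rewrite mulr_ge0//= mulr_ile1.
by move=> x Dx; rewrite indicI; apply: cvgM; [exact: pA|exact: qB].
Qed.

Lemma int_cst1_lty : (\int[mu]_(x in D) ((cst 1 x : R) ^+ 2)%:E < +oo)%E.
Proof.
rewrite (eq_integral (cst 1%E)); last by move=> x _; rewrite /= expr1n.
by rewrite integral_cst// mul1e.
Qed.

Lemma norm_sub_le1 (a b : R) : 0 <= a <= 1 -> 0 <= b <= 1 -> `|a - b| <= 1.
Proof. by move=> /andP[? ?] /andP[? ?]; rewrite ler_norml; lra. Qed.

Lemma indic01 (A : set T) x : 0 <= (\1_A x : R) <= 1.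
Proof. by rewrite indicE; case: (_ \in _); rewrite /= ?lexx ler01. Qed.

(** Proper differences of sets become differences of indicators, and increasing unions become
    dominated limits. *)
Lemma L2adherent_indic_lambda_system :
  lambda_system setT [set A | measurable A /\ L2adherent (\1_A : T -> R)].
Proof.
split=> //.
- split=> //; rewrite indicT; exact: L2adherent_mem.
- move=> A B BA [mA VA] [mB VB]; split; first exact: measurableD.
  rewrite (_ : \1__ = fun x => \1_A x - \1_B x); first exact: L2adherentB.
  apply/funext => x; rewrite !indicE in_setD.
  case: (boolP (x \in B)) => [|xB]; last by rewrite andbT subr0.
  by rewrite inE => /BA xA; rewrite mem_set//= subrr.
- move=> F ndF VF.
  have mUF : measurable (\bigcup_i F i).
    by apply: bigcup_measurable => k _; have [] := VF k.
  split=> //; apply: (@L2adherent_dominated (fun k => \1_(F k)) _ (cst 1)).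
  + by move=> k; have [] := VF k.
  + exact: measurable_indic.
  + exact: measurable_cst.
  + exact: int_cst1_lty.
  + by move=> k x Dx; apply: norm_sub_le1; exact: indic01.
  + move=> x Dx; rewrite indicE; case: (boolP (x \in _)) => [|xF].
      rewrite inE => -[i _ Fix]; apply: cvg_near_cst; exists i => //= k ik.
      by rewrite indicE mem_set//; move: Fix; exact/subsetPset/ndF.
    apply: cvg_near_cst; apply: nearW => k; rewrite indicE memNset// => Fx.
    by move: xF; rewrite notin_setE; apply; exists k.
Qed.

(** Reachability constrains a set on [D] only, hence the intersection with the measurable sets. *)
Hypothesis reachable_generates :
  @measurable d T `<=` <<s pointwise_reachable `&` @measurable d T >>.

(** Dynkin's pi-lambda theorem, with the measurable reachable sets as generating pi-system. *)
Lemma L2adherent_indic A : measurable A -> L2adherent (\1_A : T -> R).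
Proof.
move=> /reachable_generates mA.
suff : [set A | measurable A /\ L2adherent (\1_A : T -> R)] A by case.
move: A mA; apply: lambda_system_subset => //.
- by move=> A B [rA mA] [rB mB]; split; [exact: pointwise_reachableI|exact: measurableI].
- exact: L2adherent_indic_lambda_system.
move=> A [[p pV pA] mA]; split=> //.
apply: (@L2adherent_dominated p _ (cst 1)) => //.
- by move=> k; have [Vp _] := pV k; exact: L2adherent_mem.
- exact: int_cst1_lty.
- move=> k x Dx; apply: norm_sub_le1; last exact: indic01.
  by have [_] := pV k; exact.
Qed.

Lemma L2adherent_sum (I : Type) (s : seq I) (f : I -> T -> R) :
  (forall i, L2adherent (f i)) -> L2adherent (fun x => \sum_(i <- s) f i x).
Proof.
move=> Vf; elim: s => [|i s ih].
  rewrite (_ : (fun _ => _) = fun x => 0 * cst 1 x).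
    by apply: L2adherent_scale; exact: L2adherent_mem.
  by apply/funext => x; rewrite big_nil mul0r.
rewrite (_ : (fun _ => _) = fun x => f i x + \sum_(j <- s) f j x).
  exact: L2adherentD.
by apply/funext => x; rewrite big_cons.
Qed.

Lemma L2adherent_simple (h : {nnsfun T >-> R}) : L2adherent h.
Proof.
rewrite (_ : (h : T -> R) =
    fun x => \sum_(y \in range h) y * \1_(h @^-1` [set y]) x); last first.
  by apply/funext => x; exact: fimfunE.
under eq_fun do rewrite fsbig_finite//=.
by apply: L2adherent_sum => y; apply: L2adherent_scale; exact: L2adherent_indic.
Qed.

(** Simple functions increasing to [u] satisfy [0 <= h k <= u], so the error is dominated by [u]
    itself. *)
Lemma L2adherent_ge0 u : measurable_fun D u -> (forall x, D x -> 0 <= u x) ->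
  (\int[mu]_(x in D) (u x ^+ 2)%:E < +oo)%E -> L2adherent u.
Proof.
move=> meu u0 ufin; have mEu : measurable_fun D (EFin \o u).
  exact/measurable_EFinP.
pose h := nnsfun_approx mD mEu.
have Eu0 x : D x -> (0 <= (EFin \o u) x)%E by move=> Dx; rewrite lee_fin u0.
have hu x : D x -> h ^~ x @ \oo --> u x.
  by move=> Dx; have /fine_cvgP[_] := cvg_nnsfun_approx mD mEu Eu0 Dx.
apply: (@L2adherent_dominated h u u) => //.
- by move=> k; exact: L2adherent_simple.
- move=> k x Dx.
  have hk : h k x <= u x.
    rewrite -(cvg_lim _ (hu _ Dx))//; apply: nondecreasing_cvgn_le.
      by move=> i j ij; exact/lefP/(nd_nnsfun_approx mD mEu).
    by apply/cvg_ex; exists (u x); exact: hu.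
  rewrite ler_norml; have : 0 <= h k x by [].
  by have := u0 _ Dx; lra.
Qed.

Theorem L2_dense u : measurable_fun D u ->
  (\int[mu]_(x in D) (u x ^+ 2)%:E < +oo)%E -> L2adherent u.
Proof.
move=> meu ufin.
(* Treats the positive and the negative part of [u] at once. *)
have part (s : R -> R) : measurable_fun setT s -> (forall y, 0 <= s y <= `|y|) ->
    L2adherent (s \o u).
  move=> ms s0; have msu : measurable_fun D (s \o u) by exact: measurableT_comp.
  apply: L2adherent_ge0 => //; first by move=> x _; case/andP : (s0 (u x)).
  apply: le_lt_trans ufin; apply: ge0_le_integral => //.
  + by move=> x _; rewrite lee_fin sqr_ge0.
  + exact/measurable_EFinP/measurable_funX.
  + exact/measurable_EFinP/measurable_funX.
  + move=> x _; have /andP[? ?] := s0 (u x).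
    by rewrite lee_fin -[leRHS]real_normK ?num_real// lerXn2r ?nnegrE.
rewrite (_ : u = fun x => Num.max (u x) 0 - Num.max (- u x) 0); last first.
  by apply/funext => x; rewrite /Num.max; case: ltP => ?; case: ltP => ?; lra.
apply: L2adherentB.
- apply: (part (fun y => Num.max y 0)); first exact: measurable_maxr.
  by move=> y; rewrite le_max lexx orbT ge_max ler_norm normr_ge0.
- apply: (part (fun y => Num.max (- y) 0)).
    by apply: measurable_maxr => //; exact: measurable_funN.
  by move=> y; rewrite le_max lexx orbT ge_max -normrN ler_norm normr_ge0.
Qed.
End L2_density.

(** * Polynomial approximation of a step function *)

Section one_variable.
Variable R : realType.
Implicit Types (a b t x : R) (N m : nat).

Lemma bernoulli_inequality t m : -1 <= t -> 1 + m%:R * t <= (1 + t) ^+ m.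
Proof.
move=> t1; elim: m => [|m ih]; first by rewrite mul0r addr0 expr0.
rewrite exprS; apply: (@le_trans _ _ ((1 + t) * (1 + m%:R * t))).
  have m0 : 0 <= m%:R :> R by [].
  have := mulr_ge0 m0 (sqr_ge0 t); rewrite -natr1 expr2; nra.
by apply: ler_wpM2l => //; lra.
Qed.

(** With [q = (1 + t) / 2 < 1] one has [t <= q^2], so [N t^N <= (N q^N) q^N]. Bernoulli's inequality
    for [q^-1 = 1 + h] bounds [N q^N] by [h^-1], and the remaining factor [q^N] tends to 0. *)
Lemma cvg_natmul_expr t : 0 <= t -> t < 1 ->
  (fun N : nat => N%:R * t ^+ N) @ \oo --> (0 : R).
Proof.
move=> t0 t1.
pose q := (1 + t) / 2.
have q0 : 0 < q by rewrite /q; lra.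
have q1 : q < 1 by rewrite /q; lra.
have tq : t <= q * q by rewrite /q; have := sqr_ge0 (1 - t); rewrite expr2; nra.
pose h := q^-1 - 1.
have h0 : 0 < h by rewrite subr_gt0 invf_gt1.
have bound N : N%:R * t ^+ N <= h^-1 * q ^+ N.
  rewrite ler_pdivlMl// mulrA; apply: (@le_trans _ _ ((h * N%:R * q ^+ N) * q ^+ N)).
    rewrite -[leRHS]mulrA ler_wpM2l ?mulr_ge0//; first exact: ltW.
    by rewrite -exprMn lerXn2r// nnegrE mulr_ge0// ltW.
  rewrite ler_piMl ?exprn_ge0//; first exact: ltW.
  rewrite -ler_pdivlMr ?exprn_gt0// mul1r -exprVn.
  rewrite (_ : q^-1 = 1 + h); last by rewrite /h; ring.
  have hN1 : -1 <= h by lra.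
  by have := bernoulli_inequality N hN1; rewrite mulrC; lra.
apply: (@squeeze_cvgr _ _ _ _ (cst 0) (fun N => h^-1 * q ^+ N)).
- by apply: nearW => N /=; rewrite bound mulr_ge0// exprn_ge0.
- exact: cvg_cst.
- rewrite -[X in _ --> X](mulr0 h^-1); apply: cvgMl_tmp; apply: cvg_expr.
  by rewrite gtr0_norm.
Qed.

(* The polynomials of Brosowski and Deutsch; the additional factor [N] in the
   exponent makes them converge at the jump as well. *)
Definition step_poly (N : nat) x := (1 - x ^+ N) ^+ (N * 2 ^ N).

Lemma step_poly01 N x : 0 <= x <= 1 -> 0 <= step_poly N x <= 1.
Proof.
move=> /andP[x0 x1]; have ? : 0 <= x ^+ N by rewrite exprn_ge0.
have ? : x ^+ N <= 1 by rewrite exprn_ile1.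
by rewrite /step_poly exprn_ge0 ?exprn_ile1//=; lra.
Qed.

(** Put [y = x^N] and [k = N 2^N], so that [k y = N (2x)^N]. If [x < 1/2], Bernoulli gives
    [1 - k y <= (1 - y)^k <= 1], and [k y] tends to 0. If [x >= 1/2], then
    [(1 - y)^k (1 + y)^k <= 1] while [(1 + y)^k >= 1 + k y >= N + 1], so the value is at most
    [1 / (N + 1)]. *)
Lemma cvg_step_poly x : 0 <= x <= 1 ->
  step_poly ^~ x @ \oo --> ((x < 2^-1)%R%:R : R).
Proof.
move=> /[dup] x01 /andP[x0 x1].
have xN0 N : 0 <= x ^+ N by rewrite exprn_ge0.
have xN1 N : x ^+ N <= 1 by rewrite exprn_ile1.
have expE N : (N * 2 ^ N)%N%:R * x ^+ N = N%:R * (2 * x) ^+ N :> R.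
  by rewrite natrM natrX exprMn mulrA.
case: ltP => [xl|xg] /=.
  apply: (@squeeze_cvgr _ _ _ _ (fun N => 1 - N%:R * (2 * x) ^+ N) (cst 1)).
  - apply: nearW => N; have /andP[_ ->] := step_poly01 N x01; rewrite andbT -expE.
    have := @bernoulli_inequality (- x ^+ N) (N * 2 ^ N); rewrite mulrN; apply.
    by rewrite lerN2.
  - rewrite -[X in _ --> X]subr0; apply: cvgB; first exact: cvg_cst.
    by apply: cvg_natmul_expr; lra.
  - exact: cvg_cst.
apply: (@squeeze_cvgr _ _ _ _ (cst 0) (@harmonic R)).
- apply: nearW => N; have /andP[-> _] := step_poly01 N x01.
  rewrite /= /step_poly -[leRHS]mul1r ler_pdivlMr//.
  apply: (@le_trans _ _ ((1 - x ^+ N) ^+ (N * 2 ^ N) * (1 + x ^+ N) ^+ (N * 2 ^ N))).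
    apply: ler_wpM2l; first by rewrite exprn_ge0// subr_ge0.
    apply: le_trans (bernoulli_inequality _ _); last by have := xN0 N; lra.
    rewrite expE -natr1 addrC lerD2l ler_peMr// exprn_ege1//; lra.
  rewrite -exprMn -subr_sqr expr1n exprn_ile1//.
  + by rewrite subr_ge0 exprn_ile1.
  + by rewrite gerBl sqr_ge0.
- exact: cvg_cst.
- exact: cvg_harmonic.
Qed.

(** * Elementary estimates for sine and cosine *)

Lemma lipschitz_of_derive (f df : R -> R) a b :
  (forall x, is_derive x 1 f (df x)) -> (forall x, `|df x| <= 1) ->
  `|f a - f b| <= `|a - b|.
Proof.
move=> fdf df1; wlog ab : a b / b <= a.
  by move=> H; case: (leP b a) => [/H//|/ltW/H]; rewrite distrC (distrC b).
have [|x _ ->] := @MVT_segment R f df b a ab (fun x _ => fdf x).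
  apply: continuous_subspaceT => x; apply/differentiable_continuous/derivable1_diffP.
  by have [] := fdf x.
by rewrite normrM ler_piMl.
Qed.

Lemma cos_lipschitz a b : `|cos a - cos b| <= `|a - b|.
Proof.
apply: (@lipschitz_of_derive _ (fun x => - sin x)) => x.
by rewrite normrN sin_max.
Qed.

Lemma sin_lipschitz a b : `|sin a - sin b| <= `|a - b|.
Proof. by apply: (@lipschitz_of_derive _ cos) => x; exact: cos_max. Qed.

(** By oddness [x >= 0]; the mean value theorem gives [x - sin x = (1 - cos y) x] for some [y]
    between 0 and [x], and [1 - cos y] is at most [y] in absolute value. *)
Lemma norm_sub_sin_le x : `|x - sin x| <= x ^+ 2.
Proof.
wlog x0 : x / 0 <= x.
  move=> H; case: (leP 0 x) => [/H//|x0].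
  have : `|- x - sin (- x)| <= (- x) ^+ 2 by rewrite H// oppr_ge0 ltW.
  by rewrite sinN opprK sqrrN addrC distrC.
have [|y] := @MVT_segment R sin cos 0 x x0 (fun x _ => is_derive_sin x).
  by apply: continuous_subspaceT => y; exact: continuous_sin.
rewrite in_itv/= sin0 !subr0 => /andP[y0 yx] ->.
rewrite -{1}[x]mul1r -mulrBl normrM (ger0_norm x0) expr2 ler_wpM2r//.
by rewrite -cos0 (le_trans (cos_lipschitz _ _))// sub0r normrN ger0_norm.
Qed.
End one_variable.

(** * Trigonometric sums of low frequency *)

Section trigonometric_sums.
Variables (R : realType) (n : nat).
Implicit Types (b c : R) (x y xi : 'rV[R]_n) (S T : 'rV[R]_n -> R).

Lemma dotvDl x y xi : dotv (x + y) xi = dotv x xi + dotv y xi.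
Proof. by rewrite /dotv -big_split/=; apply: eq_bigr => i _; rewrite mxE mulrDl. Qed.

Lemma dotvNl x xi : dotv (- x) xi = - dotv x xi.
Proof. by rewrite /dotv -sumrN; apply: eq_bigr => i _; rewrite mxE mulNr. Qed.

Lemma dotvC x y : dotv x y = dotv y x.
Proof. by apply: eq_bigr => i _; rewrite mulrC. Qed.

Lemma dotv_delta c (i : 'I_n) xi : dotv (c *: delta_mx 0 i) xi = c * xi ord0 i.
Proof.
rewrite /dotv (bigD1 i)//= big1 ?addr0; first by rewrite !mxE !eqxx/= mulr1.
by move=> j ji; rewrite !mxE (negbTE ji) andbF mulr0 mul0r.
Qed.

Lemma measurable_dotv y : measurable_fun setT (dotv y).
Proof.
apply: measurable_sum => i.
by apply: measurable_funM => //; exact: measurable_rV_coord.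
Qed.

(** Real sums, so that the real density theorem applies to them. The phase [theta] covers sines as
    well. Frequencies are bounded coordinatewise, which adds up under products; [cube_cball0]
    relates such bounds to the Euclidean ball. *)
Inductive trig_sum b : ('rV[R]_n -> R) -> Prop :=
| trig_sum0 : trig_sum b (fun=> 0)
| trig_sum_cons c y theta T : (forall i, `|y ord0 i| <= b) -> trig_sum b T ->
    trig_sum b (fun xi => c * cos (dotv y xi + theta) + T xi).

Lemma trig_sum1 b c y theta : (forall i, `|y ord0 i| <= b) ->
  trig_sum b (fun xi => c * cos (dotv y xi + theta)).
Proof.
move=> yb; rewrite (_ : (fun _ => _) =
    fun xi => c * cos (dotv y xi + theta) + (fun=> 0) xi).
  by apply: trig_sum_cons => //; exact: trig_sum0.
by apply/funext => xi; rewrite addr0.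
Qed.

Lemma trig_sumD b S T : trig_sum b S -> trig_sum b T ->
  trig_sum b (fun xi => S xi + T xi).
Proof.
move=> bS bT; elim: bS => [|c y theta {}S yb _ ih].
  by rewrite (_ : (fun _ => _) = T)//; apply/funext => xi; rewrite add0r.
rewrite (_ : (fun _ => _) =
    fun xi => c * cos (dotv y xi + theta) + (fun xi => S xi + T xi) xi).
  exact: trig_sum_cons.
by apply/funext => xi; rewrite addrA.
Qed.

Lemma trig_sumZ b c T : trig_sum b T -> trig_sum b (fun xi => c * T xi).
Proof.
elim => [|d y theta {}T yb _ ih].
  rewrite (_ : (fun _ => _) = fun=> 0); first exact: trig_sum0.
  by apply/funext => xi; rewrite mulr0.
rewrite (_ : (fun _ => _) =
    fun xi => (c * d) * cos (dotv y xi + theta) + (fun xi => c * T xi) xi).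
  exact: trig_sum_cons.
by apply/funext => xi; rewrite mulrDr mulrA.
Qed.

Lemma cosM_cos (s t : R) : cos s * cos t = 2^-1 * cos (s + t) + 2^-1 * cos (s - t).
Proof. by rewrite cosD cosB; field. Qed.

(** By the product-to-sum formula each product of two terms yields the frequencies [y + z] and
    [y - z], with coordinates at most [b1 + b2] in absolute value. *)
Lemma trig_sum_cosM b1 b2 c y theta T : (forall i, `|y ord0 i| <= b1) ->
  trig_sum b2 T ->
  trig_sum (b1 + b2) (fun xi => (c * cos (dotv y xi + theta)) * T xi).
Proof.
move=> yb; elim => [|d z zeta {}T zb _ ih].
  rewrite (_ : (fun _ => _) = fun=> 0); first exact: trig_sum0.
  by apply/funext => xi; rewrite mulr0.
rewrite (_ : (fun _ => _) = fun xi =>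
  (c * d / 2) * cos (dotv (y + z) xi + (theta + zeta)) +
  ((fun xi => (c * d / 2) * cos (dotv (y - z) xi + (theta - zeta))) xi +
   (fun xi => c * cos (dotv y xi + theta) * T xi) xi)).
  apply: trig_sum_cons.
    by move=> i; rewrite mxE (le_trans (ler_normD _ _))// lerD.
  apply: trig_sumD => //; apply: trig_sum1 => i.
  by rewrite !mxE (le_trans (ler_normB _ _))// lerD.
apply/funext => xi /=; rewrite !dotvDl dotvNl mulrDr addrA; congr (_ + _).
rewrite mulrACA cosM_cos opprD 2!(addrACA _ theta) mulrDr.
by rewrite ![in LHS]mulrA.
Qed.

Lemma trig_sumM b1 b2 S T : trig_sum b1 S -> trig_sum b2 T ->
  trig_sum (b1 + b2) (fun xi => S xi * T xi).
Proof.
move=> bS bT; elim: bS => [|c y theta {}S yb _ ih].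
  rewrite (_ : (fun _ => _) = fun=> 0); first exact: trig_sum0.
  by apply/funext => xi; rewrite mul0r.
rewrite (_ : (fun _ => _) = fun xi =>
    (fun xi => (c * cos (dotv y xi + theta)) * T xi) xi +
    (fun xi => S xi * T xi) xi); last by apply/funext => xi; rewrite mulrDl.
by apply: trig_sumD => //; exact: trig_sum_cosM.
Qed.

Lemma trig_sum_bounded b T : trig_sum b T -> exists K, forall xi, `|T xi| <= K.
Proof.
elim => [|c y theta {}T yb _ [K TK]]; first by exists 0 => xi; rewrite normr0.
exists (`|c| + K) => xi; rewrite (le_trans (ler_normD _ _))// lerD//.
by rewrite normrM ler_piMr// cos_max.
Qed.

(** * The algebra of low-frequency functions on [D] *)

Variable D : set 'rV[R]_n.

Definition low_frequency (p : 'rV[R]_n -> R) := measurable_fun setT p /\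
  forall b e : R, 0 < b -> 0 < e ->
    exists2 T, trig_sum b T & forall xi, D xi -> `|p xi - T xi| <= e.

(** Some bounded trigonometric sum lies within 1 of [p] on [D]. The bound is needed to estimate
    products. *)
Lemma low_frequency_bounded p : low_frequency p ->
  exists2 K, 0 <= K & forall xi, D xi -> `|p xi| <= K.
Proof.
move=> [_ /(_ 1 1 ltr01 ltr01)[T /trig_sum_bounded[K TK] pT]].
have K0 : 0 <= K by apply: le_trans (TK 0).
exists (1 + K) => [|xi Dxi]; first by rewrite addr_ge0.
by rewrite -(subrK (T xi) (p xi)) (le_trans (ler_normD _ _))// lerD// pT.
Qed.

Lemma low_frequency_cst1 : low_frequency (cst 1).
Proof.
split=> // b e b0 e0; exists (fun xi => 1 * cos (dotv 0 xi + 0)).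
  by apply: trig_sum1 => i; rewrite mxE normr0 ltW.
move=> xi _; rewrite addr0 (_ : dotv 0 xi = 0); last first.
  by rewrite /dotv big1// => i _; rewrite mxE mul0r.
by rewrite cos0 mul1r subrr normr0 ltW.
Qed.

Lemma low_frequencyD p q : low_frequency p -> low_frequency q ->
  low_frequency (fun xi => p xi + q xi).
Proof.
move=> [mp Vp] [mq Vq]; split=> [|b e b0 e0]; first exact: measurable_funD.
have e2 : 0 < e / 2 by rewrite divr_gt0.
have [S bS pS] := Vp _ _ b0 e2; have [T bT qT] := Vq _ _ b0 e2.
exists (fun xi => S xi + T xi); first exact: trig_sumD.
move=> xi Dxi; rewrite opprD addrACA (le_trans (ler_normD _ _))//.
by rewrite [leRHS]splitr lerD ?pS ?qT.
Qed.

Lemma low_frequencyZ c p : low_frequency p -> low_frequency (fun xi => c * p xi).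
Proof.
move=> [mp Vp]; split=> [|b e b0 e0]; first exact: measurable_funM.
have c0 : 0 < `|c| + 1 by rewrite ltr_wpDl.
have [S bS pS] := Vp _ _ b0 (divr_gt0 e0 c0).
exists (fun xi => c * S xi); first exact: trig_sumZ.
move=> xi Dxi; rewrite -mulrBr normrM.
apply: (@le_trans _ _ ((`|c| + 1) * `|p xi - S xi|)).
  by rewrite ler_wpM2r// lerDl.
by rewrite -ler_pdivlMl// mulrC pS.
Qed.

Lemma low_frequencyM p q : low_frequency p -> low_frequency q ->
  low_frequency (fun xi => p xi * q xi).
Proof.
move=> Vp Vq; have [K K0 pK] := low_frequency_bounded Vp.
have [L L0 qL] := low_frequency_bounded Vq.
have [[mp {}Vp] [mq {}Vq]] := (Vp, Vq).
split=> [|b e b0 e0]; first exact: measurable_funM.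
(* Each factor receives half of the frequency allowance. *)
have b2 : 0 < b / 2 by rewrite divr_gt0.
have KL0 : 0 < K + L + 1 by rewrite ltr_wpDl// addr_ge0.
(* If both errors are at most [r <= 1], then [|T| <= L + 1], and the error of the product is at most
   [K r + (L + 1) r]. *)
pose r := Num.min 1 (e / (K + L + 1)).
have r0 : 0 < r by rewrite lt_min ltr01 divr_gt0.
have r1 : r <= 1 by rewrite ge_min lexx.
have re : r * (K + L + 1) <= e by rewrite -ler_pdivlMr// ge_min lexx orbT.
have [S bS pS] := Vp _ _ b2 r0; have [T bT qT] := Vq _ _ b2 r0.
exists (fun xi => S xi * T xi); first by rewrite [b]splitr; exact: trig_sumM.
move=> xi Dxi; have := pS _ Dxi; have := qT _ Dxi.
have := pK _ Dxi; have := qL _ Dxi.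
rewrite (_ : p xi * q xi - S xi * T xi =
  p xi * (q xi - T xi) + (q xi - (q xi - T xi)) * (p xi - S xi)); last by ring.
move: (p xi) (q xi) (q xi - T xi) (p xi - S xi) => u v s t vL uK sr tr.
rewrite (le_trans (ler_normD _ _))// !normrM.
have vsL : `|v - s| <= L + 1.
  by rewrite (le_trans (ler_normB _ _))// lerD// (le_trans sr).
apply: le_trans re; rewrite [leRHS]mulrC -addrA mulrDl lerD//; exact: ler_pM.
Qed.

Lemma low_frequencyX p k : low_frequency p -> low_frequency (fun xi => p xi ^+ k).
Proof.
move=> Vp; elim: k => [|k ih].
  by rewrite (_ : (fun _ => _) = cst 1)//; exact: low_frequency_cst1.
rewrite (_ : (fun _ => _) = fun xi => p xi * p xi ^+ k); first exact: low_frequencyM.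
by apply/funext => xi; rewrite exprS.
Qed.

Variable M : R.
Hypothesis DM : forall xi, D xi -> forall i, `|xi ord0 i| <= M.

(* [xi_i] is the limit of [sin (h * xi_i) / h] as [h] tends to 0. *)
Lemma low_frequency_coord i : low_frequency (fun xi => xi ord0 i).
Proof.
split=> [|b e b0 e0]; first exact: measurable_rV_coord.
have M0 : 0 < M ^+ 2 + 1 by rewrite ltr_wpDl// sqr_ge0.
(* The bound [h <= b] limits the frequency, and the error [h^-1 (h xi_i)^2 = h xi_i^2] is at most
   [h M^2 <= e]. The phase [- pi / 2] below turns the cosine into a sine. *)
pose h := Num.min b (e / (M ^+ 2 + 1)).
have h0 : 0 < h by rewrite lt_min b0 divr_gt0.
have hb : h <= b by rewrite ge_min lexx.
have he : h * (M ^+ 2 + 1) <= e by rewrite -ler_pdivlMr// ge_min lexx orbT.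
exists (fun xi => h^-1 * cos (dotv (h *: delta_mx 0 i) xi + (- (pi / 2)))).
  apply: trig_sum1 => j; rewrite !mxE eqxx/=.
  by case: (_ == _); rewrite ?mulr1 ?mulr0 ?normr0 ?(ltW b0)// gtr0_norm.
move=> xi Dxi; rewrite dotv_delta cosBpihalf.
rewrite -[X in X - _](mulKf (lt0r_neq0 h0)) -mulrBr normrM gtr0_norm ?invr_gt0//.
rewrite ler_pdivrMl//; apply: le_trans (norm_sub_sin_le _) _.
rewrite exprMn expr2 -mulrA ler_wpM2l ?(ltW h0)//.
apply: le_trans he; rewrite ler_wpM2l ?(ltW h0)// ler_wpDr//.
by rewrite -real_normK ?num_real// lerXn2r ?nnegrE ?DM ?(le_trans _ (DM Dxi i)).
Qed.

End trigonometric_sums.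

(** * Half-spaces as pointwise limits of low-frequency functions *)

Section halfspaces.
Variables (R : realType) (n : nat) (D : set 'rV[R]_n) (M : R).
Hypothesis DM : forall xi, D xi -> forall i, `|xi ord0 i| <= M.

Lemma low_frequency_step i (s c : R) N : low_frequency D
  (fun xi : 'rV[R]_n => step_poly N (2^-1 + s * (xi ord0 i - c))).
Proof.
have V1 r : low_frequency D (fun=> r).
  rewrite (_ : (fun=> r) = fun xi : 'rV[R]_n => r * cst 1 xi).
    exact/low_frequencyZ/low_frequency_cst1.
  by apply/funext => xi; rewrite mulr1.
apply: low_frequencyX; apply: low_frequencyD (V1 1) _.
rewrite (_ : (fun _ => _) =
    fun xi : 'rV[R]_n => -1 * (2^-1 + s * (xi ord0 i - c)) ^+ N); last first.
  by apply/funext => xi; rewrite mulN1r.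
apply/low_frequencyZ/low_frequencyX; apply: low_frequencyD (V1 _) _.
apply: low_frequencyZ; apply: low_frequencyD (V1 _).
exact: low_frequency_coord DM i.
Qed.

(** An affine change of variable sends [c] to the jump [1/2] of the step polynomials and the [i]-th
    coordinates of points of [D] into [[0, 1]]. *)
Lemma pointwise_reachable_halfspace i c :
  pointwise_reachable D (low_frequency D) [set xi : 'rV[R]_n | xi ord0 i < c].
Proof.
pose K := `|M| + `|c| + 1.
have K0 : 0 < K by rewrite ltr_wpDl// addr_ge0.
pose s := (4 * K)^-1.
have s0 : 0 < s by rewrite invr_gt0 mulr_gt0.
pose x (xi : 'rV[R]_n) := 2^-1 + s * (xi ord0 i - c).
have x01 xi : D xi -> 0 <= x xi <= 1.
  move=> Dxi; have xK : `|xi ord0 i - c| <= K.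
    rewrite (le_trans (ler_normB _ _))// ler_wpDr// lerD//.
    exact: le_trans (DM Dxi i) (ler_norm _).
  suff : `|s * (xi ord0 i - c)| <= 2^-1 by rewrite /x ler_norml; lra.
  rewrite normrM gtr0_norm// mulrC ler_pdivrMr ?mulr_gt0//.
  by apply: le_trans xK _; lra.
exists (fun N xi => step_poly N (x xi)).
  move=> N; split; first exact: (low_frequency_step i s c N).
  by move=> xi Dxi; apply/step_poly01/x01.
move=> xi Dxi; have := cvg_step_poly (x01 _ Dxi).
have -> : (x xi < 2^-1) = (xi ord0 i < c).
  by rewrite /x -subr_lt0 addrAC subrr add0r pmulr_rlt0// subr_lt0.
by rewrite indicE; case: ltP => xic; [rewrite mem_set|rewrite memNset//= le_gtF].
Qed.

Lemma halfspaces_generate : @measurable _ 'rV[R]_n `<=`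
  <<s pointwise_reachable D (low_frequency D) `&` @measurable _ 'rV[R]_n >>.
Proof.
set G := _ `&` _; have sG := smallest_sigma_algebra setT G.
apply: smallest_sub => //; rewrite -bigcup_seq => B [i _ [C mC <-]] /=.
rewrite setTI.
have : <<s @RGenInftyO.G R >> C.
  have : (@ocitv R).-sigma.-measurable C by exact: mC.
  by rewrite RGenInftyO.measurableE.
(* The sets [C] whose cylinder over the [i]-th coordinate lies in the generated sigma-algebra form a
   sigma-algebra themselves, so it suffices to treat the open rays generating the Borel sets. *)
pose H : set (set R) := [set C | <<s G >> (@rV_coord R n i @^-1` C)].
rewrite -[<<s G>> _]/(H C); move: C {mC}; apply: smallest_sub.
  case: sG => G0 GC GU; split; rewrite /H/=.
  - by rewrite preimage_set0.
  - by move=> C HC; rewrite setTD preimage_setC -setTD; exact: GC.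
  - by move=> F HF; rewrite preimage_bigcup; exact: GU.
move=> _ [c ->]; rewrite /H /=; apply: sub_sigma_algebra.
rewrite (_ : _ @^-1` _ = [set xi : 'rV[R]_n | xi ord0 i < c]); last first.
  by apply/seteqP; split=> xi; rewrite /= in_itv.
split; first exact: pointwise_reachable_halfspace.
rewrite (_ : [set _ | _] = setT `&` @rV_coord R n i @^-1` `]-oo, c[).
  exact: measurable_rV_coord.
by apply/seteqP; split=> xi /=; rewrite in_itv => // -[].
Qed.

End halfspaces.

(** * Approximation by Fourier transforms *)

Section fourier_approximation.
Local Open Scope complex_scope.
Variables (R : realType) (n : nat).
Local Notation mu := (lebesgue_rV R n).
Implicit Types (x y xi : 'rV[R]_n) (z : R[i]) (B : set 'rV[R]_n).

Lemma normc_Re z : `|complex.Re z| <= normc z.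
Proof. by case: z => s t /=; rewrite -sqrtr_sqr ler_wsqrtr// lerDl sqr_ge0. Qed.

Lemma normc_Im z : `|complex.Im z| <= normc z.
Proof. by case: z => s t /=; rewrite -sqrtr_sqr ler_wsqrtr// lerDr sqr_ge0. Qed.

Lemma normc_le z : normc z <= `|complex.Re z| + `|complex.Im z|.
Proof.
case: z => s t /=; rewrite -[leRHS]ger0_norm ?addr_ge0// -sqrtr_sqr ler_wsqrtr//.
rewrite sqrrD !real_normK ?num_real// lerD2r lerDl.
by rewrite mulrn_wge0// mulr_ge0.
Qed.

Lemma normc_real (r : R) : normc r%:C = `|r|.
Proof. by rewrite /= expr0n addr0 sqrtr_sqr. Qed.

Lemma normc_expi (t : R) : normc (expi t) = 1.
Proof. by rewrite /= cos2Dsin2 sqrtr1. Qed.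

Lemma expiD (s t : R) : expi (s + t) = expi s * expi t.
Proof. by rewrite /expi; simpc; rewrite cosD sinD [sin s * cos t + _]addrC. Qed.

Lemma cos_expi (s t : R) : (cos (s + t))%:C =
  (2^-1)%:C * (expi t * expi s) + (2^-1)%:C * (expi (- t) * expi (- s)).
Proof.
rewrite -!expiD [t + s]addrC -opprD addrC /expi cosN sinN addrC; simpc.
by congr (_ +i* _); field.
Qed.

Lemma dotv_le x y r s : (forall i, `|x ord0 i| <= r) -> (forall i, `|y ord0 i| <= s) ->
  `|dotv x y| <= n%:R * (r * s).
Proof.
move=> xr ys; apply: (le_trans (ler_norm_sum _ _ _)).
apply: (@le_trans _ _ (\sum_(i < n) r * s)).
  by apply: ler_sum => i _; rewrite normrM ler_pM.
by rewrite sumr_const card_ord mulr_natl.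
Qed.

(** Cubes rather than Euclidean balls: they are products of intervals, so [lebesgue_rV_box] gives
    their volume. *)
Definition cube y (r : R) := [set x : 'rV[R]_n | forall i, `|x ord0 i - y ord0 i| <= r].

Lemma cubeE y r : cube y r =
  [set x : 'rV[R]_n | forall i, `[y ord0 i - r, y ord0 i + r]%classic (x ord0 i)].
Proof.
by apply/seteqP; split=> x yx i; have := yx i; rewrite /= in_itv/= ler_distl.
Qed.

Lemma measurable_cube y r : measurable (cube y r).
Proof.
rewrite cubeE (_ : [set x | _] = \bigcap_(i in [set: 'I_n])
    (@rV_coord R n i @^-1` `[y ord0 i - r, y ord0 i + r])).
  apply: fin_bigcap_measurable => // i _.
  by rewrite -[X in measurable X]setTI; exact: measurable_rV_coord.
by apply/seteqP; split=> x yx i; [move=> _; exact: yx|exact: (yx i I)].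
Qed.

Lemma lebesgue_cube y r : 0 < r -> mu (cube y r) = ((r *+ 2) ^+ n)%:E.
Proof.
move=> r0; rewrite cubeE.
rewrite (@lebesgue_rV_box R n (fun i => `[y ord0 i - r, y ord0 i + r]%classic))//.
rewrite (eq_bigr (fun=> (r *+ 2)%:E)); last first.
  move=> i _; rewrite lebesgue_measure_itv/= lte_fin ifT; last by lra.
  by rewrite -EFinB; congr (_%:E); ring.
by rewrite -(@big_morph _ _ EFin 1%E *%E 1 *%R)// prodr_const card_ord.
Qed.

Lemma bounded_finite_measure B r : measurable B ->
  (forall x, B x -> forall i, `|x ord0 i| <= r) -> (mu B < +oo)%E.
Proof.
(* The half-side [|r| + 1] is positive whatever the sign of [r], as [lebesgue_cube] requires. *)
move=> mB Br; apply: (@le_lt_trans _ _ (mu (cube 0 (`|r| + 1)))).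
  apply: le_measure; rewrite ?inE//; first exact: measurable_cube.
  move=> x Bx i; rewrite mxE subr0 (le_trans (Br _ Bx i))//.
  by rewrite (le_trans (ler_norm _))// lerDl.
by rewrite lebesgue_cube ?ltry// ltr_wpDl.
Qed.

(** * Bounded functions on the ball and their Fourier transforms *)

Variables (a : R) (a0 : 0 < a).
Let B := cball0 a : set 'rV[R]_n.

Lemma cball0_coord x i : B x -> `|x ord0 i| <= a.
Proof.
rewrite /B /cball0 /= /enorm => xa; apply: le_trans xa.
rewrite -sqrtr_sqr ler_wsqrtr// /dotv (bigD1 i)//= -expr2 lerDl.
by apply: sumr_ge0 => j _; rewrite -expr2 sqr_ge0.
Qed.

(** The squared Euclidean norm is at most [n (a / (n + 1))^2], and [n <= (n + 1)^2]. *)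
Lemma cube_cball0 x : (forall i, `|x ord0 i| <= a / n.+1%:R) -> B x.
Proof.
move=> xa; rewrite /B /cball0 /= /enorm -[leRHS]ger0_norm ?(ltW a0)// -sqrtr_sqr.
rewrite ler_wsqrtr//; apply: le_trans (ler_norm _) _.
apply: le_trans (dotv_le xa xa) _; rewrite -expr2 expr_div_n mulrCA ler_piMr ?sqr_ge0//.
rewrite ler_pdivrMr ?exprn_gt0// mul1r -natrX ler_nat.
by rewrite -mulnn (leq_trans (leqnSn n))// leq_pmulr.
Qed.

Let mB : measurable B. Proof. exact: measurable_cball0. Qed.
Let Bfin : (mu B < +oo)%E.
Proof. by apply: (bounded_finite_measure mB) => x /[swap] i; exact: cball0_coord. Qed.

(** A class that contains the exponentials, is stable under sums and products, and on the ball, of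
    finite measure, consists of integrable functions; this makes the transform linear on it. *)
Definition bounded_mfun (f : 'rV[R]_n -> R[i]) :=
  [/\ measurable_fun setT (fun x => complex.Re (f x)),
      measurable_fun setT (fun x => complex.Im (f x))
    & exists K, forall x, normc (f x) <= K].

Lemma bounded_mfunD f g : bounded_mfun f -> bounded_mfun g ->
  bounded_mfun (fun x => f x + g x).
Proof.
move=> [mRf mIf [K fK]] [mRg mIg [L gL]]; split.
- rewrite (_ : (fun _ => _) = fun x => complex.Re (f x) + complex.Re (g x)).
    exact: measurable_funD.
  by apply/funext => x; case: (f x); case: (g x).
- rewrite (_ : (fun _ => _) = fun x => complex.Im (f x) + complex.Im (g x)).
    exact: measurable_funD.
  by apply/funext => x; case: (f x); case: (g x).
- by exists (K + L) => x; rewrite (le_trans (le_normcD _ _))// lerD.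
Qed.

Lemma bounded_mfunM f g : bounded_mfun f -> bounded_mfun g ->
  bounded_mfun (fun x => f x * g x).
Proof.
move=> [mRf mIf [K fK]] [mRg mIg [L gL]]; split.
- rewrite (_ : (fun _ => _) = fun x => complex.Re (f x) * complex.Re (g x) -
      complex.Im (f x) * complex.Im (g x)).
    by apply: measurable_funB; exact: measurable_funM.
  by apply/funext => x; case: (f x); case: (g x).
- rewrite (_ : (fun _ => _) = fun x => complex.Re (f x) * complex.Im (g x) +
      complex.Im (f x) * complex.Re (g x)).
    by apply: measurable_funD; exact: measurable_funM.
  by apply/funext => x; case: (f x); case: (g x).
- exists (K * L) => x; rewrite normcM ler_pM//.
  + by case: (f x) => s t; exact: sqrtr_ge0.
  + by case: (g x) => s t; exact: sqrtr_ge0.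
Qed.

Lemma bounded_mfun_cst z : bounded_mfun (fun=> z).
Proof. by split=> //; exists (normc z). Qed.

Lemma bounded_mfun_expi_dotv xi : bounded_mfun (fun x => expi (dotv xi x)).
Proof.
split; last by exists 1 => x; rewrite normc_expi.
- apply: (measurableT_comp (f := @cos R)); last exact: measurable_dotv.
  by apply: continuous_measurable_fun; exact: continuous_cos.
- apply: (measurableT_comp (f := @sin R)); last exact: measurable_dotv.
  by apply: continuous_measurable_fun; exact: continuous_sin.
Qed.

Lemma bounded_real_integrable (f : 'rV[R]_n -> R) K : measurable_fun setT f ->
  (forall x, `|f x| <= K) -> mu.-integrable B (EFin \o f).
Proof.
move=> mf fK; apply: measurable_bounded_integrable => //; first exact: measurable_funTS.
by exists K; split; [exact: num_real|move=> L KL x _; exact: le_trans (fK x) (ltW KL)].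
Qed.

Lemma bounded_mfun_integrable f : bounded_mfun f ->
  mu.-integrable B (EFin \o (fun x => complex.Re (f x))) /\
  mu.-integrable B (EFin \o (fun x => complex.Im (f x))).
Proof.
move=> [mR mI [K fK]].
split; apply: (@bounded_real_integrable _ K) => // x; apply: le_trans (fK x).
  exact: normc_Re.
exact: normc_Im.
Qed.

Lemma cintegralD f g : bounded_mfun f -> bounded_mfun g ->
  cintegral B (fun x => f x + g x) = cintegral B f + cintegral B g.
Proof.
move=> /bounded_mfun_integrable[Rf If] /bounded_mfun_integrable[Rg Ig].
rewrite /cintegral; simpc; rewrite -!RintegralD//.
by congr (_ +i* _); apply: eq_Rintegral => x _; case: (f x); case: (g x).
Qed.

Lemma cintegralZ z f : bounded_mfun f ->
  cintegral B (fun x => z * f x) = z * cintegral B f.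
Proof.
move=> /bounded_mfun_integrable[Rf If].
have iZ (r : R) (h : 'rV[R]_n -> R) : mu.-integrable B (EFin \o h) ->
  mu.-integrable B (EFin \o (fun x => r * h x)) by exact: integrableZl.
case: z => s t; rewrite /cintegral; simpc; rewrite -!RintegralZl//.
rewrite -RintegralB -?RintegralD//; try exact: iZ.
by congr (_ +i* _); apply: eq_Rintegral => x _; case: (f x).
Qed.

Lemma fourier_ballD f g xi : bounded_mfun f -> bounded_mfun g ->
  fourier_ball a (fun x => f x + g x) xi = fourier_ball a f xi + fourier_ball a g xi.
Proof.
move=> bf bg; rewrite /fourier_ball -cintegralD; last 2 first.
- by apply: bounded_mfunM => //; exact: bounded_mfun_expi_dotv.
- by apply: bounded_mfunM => //; exact: bounded_mfun_expi_dotv.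
by congr cintegral; apply/funext => x; rewrite mulrDl.
Qed.

Lemma fourier_ballZ z f xi : bounded_mfun f ->
  fourier_ball a (fun x => z * f x) xi = z * fourier_ball a f xi.
Proof.
move=> bf; rewrite /fourier_ball -cintegralZ; last first.
  by apply: bounded_mfunM => //; exact: bounded_mfun_expi_dotv.
by congr cintegral; apply/funext => x; rewrite mulrA.
Qed.

(** * The L^2 norm expressed by the integral of the squared modulus *)

Lemma sqr_normc z : normc z ^+ 2 = complex.Re z ^+ 2 + complex.Im z ^+ 2.
Proof. by case: z => s t /=; rewrite sqr_sqrtr// addr_ge0// sqr_ge0. Qed.

Lemma L2norm_sqr (D : set 'rV[R]_n) (F : 'rV[R]_n -> R[i]) :
  ((L2norm D F) `^ 2 = \int[mu]_(x in D) (normc (F x) ^+ 2)%:E)%E.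
Proof.
rewrite /L2norm poweR_Lnorm// [RHS]integral_mkcond; apply: eq_integral => x _.
rewrite /patch; case: ifP => _; last by rewrite abse0 poweR0r.
by rewrite poweR_EFin powR_mulrn// real_normK// num_real.
Qed.

Lemma L2norm_lty (D : set 'rV[R]_n) (F : 'rV[R]_n -> R[i]) :
  (L2norm D F < +oo)%E <-> (\int[mu]_(x in D) (normc (F x) ^+ 2)%:E < +oo)%E.
Proof.
by rewrite -L2norm_sqr; split; [exact: poweR_lty|exact: lty_poweRy].
Qed.

Lemma L2norm_lt (D : set 'rV[R]_n) (F : 'rV[R]_n -> R[i]) e : 0 < e ->
  (\int[mu]_(x in D) (normc (F x) ^+ 2)%:E < (e ^+ 2)%:E)%E ->
  (L2norm D F < e%:E)%E.
Proof.
move=> e0; rewrite -L2norm_sqr => Fe.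
have Foo : (L2norm D F < +oo)%E.
  by apply: (@lty_poweRy _ _ 2) => //; apply: lt_trans Fe _; exact: ltry.
have F0 : (0 <= L2norm D F)%E by exact: Lnorm_ge0.
move: Fe F0 Foo; case: (L2norm D F) => // r.
rewrite poweR_EFin !lte_fin lee_fin => + r0 _.
by rewrite powR_mulrn// ltr_pXn2r ?nnegrE ?(ltW e0).
Qed.

Lemma bounded_mfun_L2 f : bounded_mfun f -> L2 B f.
Proof.
move=> [mR mI [K fK]]; split; [exact: measurable_funTS|exact: measurable_funTS|].
apply/L2norm_lty; apply: (@le_lt_trans _ _ (\int[mu]_(x in B) (cst (K ^+ 2)%:E x))%E).
  apply: ge0_le_integral => //.
  - by move=> x _; rewrite lee_fin sqr_ge0.
  - under eq_fun do rewrite sqr_normc.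
    apply/measurable_EFinP/measurable_funD; apply: measurable_funX;
      exact: measurable_funTS.
  - move=> x _; have n0 : 0 <= normc (f x) by case: (f x) => s t; exact: sqrtr_ge0.
    by rewrite lee_fin lerXn2r ?nnegrE// (le_trans n0).
by rewrite integral_cst// lte_mul_pinfty// lee_fin sqr_ge0.
Qed.

(** The normalised indicator is nonnegative with integral 1 over the ball, so [c] can be moved under
    the integral, and the average of [|h - c|] over the cube is at most [e]. *)
Lemma cube_average y r (h : 'rV[R]_n -> R) (c e : R) : 0 < r ->
  cube y r `<=` B -> measurable_fun setT h -> (forall x, `|h x| <= 1) ->
  (forall x, cube y r x -> `|h x - c| <= e) ->
  `|\int[mu]_(x in B) ((fine (mu (cube y r)))^-1 * \1_(cube y r) x * h x) - c| <= e.
Proof.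
move=> r0 QB mh h1 he; set Q := cube y r; set k := (fine (mu Q))^-1.
have mQ : measurable Q := measurable_cube y r.
have k0 : 0 < k by rewrite invr_gt0 lebesgue_cube//= exprn_gt0// pmulrn_lgt0.
have kQ : k * fine (mu Q) = 1.
  by rewrite mulVf// lebesgue_cube//= expf_neq0// mulrn_eq0/= gt_eqF.
have avg_cst s : \int[mu]_(x in B) (k * \1_Q x * s) = s.
  rewrite (eq_Rintegral (g := fun x => (k * s) * \1_Q x) mu); last by move=> x _; ring.
  rewrite RintegralZl//; last first.
    apply: (@bounded_real_integrable _ 1); first exact: measurable_indic.
    by move=> x; rewrite indicE; case: (_ \in _); rewrite ?normr1 ?normr0.
  rewrite /Rintegral integral_indic// setIidl// mulrAC kQ mul1r//.
have bk (g : 'rV[R]_n -> R) K : measurable_fun setT g -> (forall x, `|g x| <= K) ->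
    mu.-integrable B (EFin \o (fun x => k * \1_Q x * g x)).
  move=> mg gK; apply: (@bounded_real_integrable _ (k * K)).
    by apply: measurable_funM => //; apply: measurable_funM => //; exact: measurable_indic.
  move=> x; rewrite !normrM (gtr0_norm k0) -mulrA ler_wpM2l ?(ltW k0)//.
  rewrite indicE; case: (_ \in _); rewrite ?normr1 ?normr0 ?mul1r ?mul0r//.
  exact: le_trans (gK x).
have mhc : measurable_fun setT (fun x => h x - c) by exact: measurable_funB.
have hc1 x : `|h x - c| <= 1 + `|c| by rewrite (le_trans (ler_normB _ _))// lerD.
rewrite -[X in _ - X](avg_cst c) -RintegralB//; last 2 first.
- exact: bk h1.
- by apply: (bk _ `|c|) => //; exact: lexx.
rewrite (eq_Rintegral (g := fun x => k * \1_Q x * (h x - c)) mu); last first.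
  by move=> x _; rewrite mulrBr.
apply: le_trans (le_normr_Rintegral _ (bk _ _ mhc hc1)) _ => //.
rewrite -[leRHS](avg_cst e); apply: le_Rintegral => //.
- rewrite (_ : EFin \o _ = EFin \o (fun x => k * \1_Q x * `|h x - c|)).
    apply: (bk _ (1 + `|c|)); first exact: measurableT_comp.
    by move=> x; rewrite normr_id.
  apply/funext => x /=; rewrite !normrM (gtr0_norm k0); congr ((_ * _ * _)%:E).
  by rewrite indicE; case: (_ \in _); rewrite ?normr1 ?normr0.
- by apply: (bk _ `|e|) => //; exact: lexx.
- move=> x _; rewrite !normrM (gtr0_norm k0) -!mulrA ler_wpM2l ?(ltW k0)//.
  rewrite indicE; case: (boolP (x \in Q)) => [|_]; last by rewrite normr0 !mul0r.
  by rewrite inE normr1 !mul1r; exact: he.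
Qed.

(** * Uniform approximation on [D] by Fourier transforms of bounded functions *)

Variables (D : set 'rV[R]_n) (M : R).
Hypothesis DM : forall xi, D xi -> forall i, `|xi ord0 i| <= M.

Definition fourier_approximable (F : 'rV[R]_n -> R[i]) := forall e : R, 0 < e ->
  exists2 f, bounded_mfun f &
    forall xi, D xi -> normc (F xi - fourier_ball a f xi) <= e.

Lemma fourier_approximable0 : fourier_approximable (fun=> 0).
Proof.
move=> e e0; exists (fun=> 0); first exact: bounded_mfun_cst.
(* Writing the zero function as [0 * 0] lets homogeneity show that its transform vanishes. *)
move=> xi _; rewrite -[fun=> 0](_ : (fun=> 0 * 0) = _); last first.
  by apply/funext => x; rewrite mulr0.
rewrite fourier_ballZ; last exact: bounded_mfun_cst.
by rewrite mul0r subrr normc0 ltW.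
Qed.

Lemma fourier_approximableD F G :
  fourier_approximable F -> fourier_approximable G ->
  fourier_approximable (fun xi => F xi + G xi).
Proof.
move=> FA GA e e0; have e2 : 0 < e / 2 by rewrite divr_gt0.
have [f bf Ff] := FA _ e2; have [g bg Gg] := GA _ e2.
exists (fun x => f x + g x); first exact: bounded_mfunD.
move=> xi Dxi; rewrite fourier_ballD// opprD addrACA.
by rewrite (le_trans (le_normcD _ _))// [leRHS]splitr lerD ?Ff ?Gg.
Qed.

Lemma fourier_approximableZ z F : fourier_approximable F ->
  fourier_approximable (fun xi => z * F xi).
Proof.
move=> FA e e0; have z0 : 0 <= normc z by case: z => s t; exact: sqrtr_ge0.
have z1 : 0 < normc z + 1 by rewrite ltr_wpDl.
have [f bf Ff] := FA _ (divr_gt0 e0 z1).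
exists (fun x => z * f x).
  by apply: bounded_mfunM => //; exact: bounded_mfun_cst.
move=> xi Dxi; rewrite fourier_ballZ// -mulrBr normcM.
have n0 : 0 <= normc (F xi - fourier_ball a f xi).
  by case: (_ - _) => s t; exact: sqrtr_ge0.
apply: (@le_trans _ _ ((normc z + 1) * normc (F xi - fourier_ball a f xi))).
  by rewrite ler_wpM2r// lerDl.
by rewrite -ler_pdivlMl// mulrC Ff.
Qed.

(** Half the bound of [cube_cball0]: a cube of half-side at most [b], centred at a point with
    coordinates at most [b] in absolute value, stays in the ball. *)
Let b := a / n.+1%:R / 2.

(** On a small cube around [y] the phase [dotv xi x] is nearly [dotv xi y], uniformly in [xi]
    because [D] is bounded; averaging over the cube thus nearly reproduces the exponential at
    [y]. *)
Lemma fourier_approximable_expi y : (forall i, `|y ord0 i| <= b) ->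
  fourier_approximable (fun xi => expi (dotv y xi)).
Proof.
move=> yb e e0; have b0 : 0 < b by rewrite !divr_gt0.
(* On the cube the phase varies by at most [n r |M| <= r L]. Half of [e] is reserved for the real
   part and half for the imaginary part. *)
pose L := n%:R * `|M| + 1.
have L0 : 0 < L by rewrite ltr_wpDl// mulr_ge0.
pose r := Num.min b (e / 2 / L).
have r0 : 0 < r by rewrite lt_min b0 !divr_gt0.
have rb : r <= b by rewrite ge_min lexx.
have re : r * L <= e / 2 by rewrite -ler_pdivlMr// ge_min lexx orbT.
have QB : cube y r `<=` B.
  move=> x yx; apply: cube_cball0 => i.
  rewrite -(subrK (y ord0 i) (x ord0 i)) (le_trans (ler_normD _ _))//.
  by rewrite [leRHS]splitr lerD// (le_trans (yx i)).
have osc xi x : D xi -> cube y r x -> `|dotv xi x - dotv y xi| <= e / 2.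
  move=> Dxi yx; rewrite dotvC -dotvNl -dotvDl.
  have yx' i : `|(x - y) ord0 i| <= r by rewrite !mxE.
  have xiM i : `|xi ord0 i| <= `|M| by rewrite (le_trans (DM Dxi i))// ler_norm.
  apply: le_trans (dotv_le yx' xiM) _; apply: le_trans re.
  by rewrite mulrCA ler_wpM2l ?(ltW r0)// lerDl.
pose f x := ((fine (mu (cube y r)))^-1 * \1_(cube y r) x)%:C.
have bf : bounded_mfun f.
  split.
  - by apply: measurable_funM => //; apply: measurable_indic; exact: measurable_cube.
  - exact: measurable_cst.
  - exists `|(fine (mu (cube y r)))^-1| => x; rewrite normc_real normrM ler_piMr//.
    by rewrite indicE; case: (_ \in _); rewrite ?normr1 ?normr0.
exists f => // xi Dxi; rewrite (le_trans (normc_le _))// [leRHS]splitr.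
rewrite /fourier_ball /cintegral /expi; simpc; apply: lerD; rewrite distrC.
- rewrite (eq_Rintegral (g := fun x => (fine (mu (cube y r)))^-1 *
      \1_(cube y r) x * cos (dotv xi x)) mu); last by move=> x _; rewrite /f; simpc.
  apply: cube_average => //.
  + by have [] := bounded_mfun_expi_dotv xi.
  + by move=> x; exact: cos_max.
  + by move=> x yx; apply: le_trans (cos_lipschitz _ _) _; exact: osc.
- rewrite (eq_Rintegral (g := fun x => (fine (mu (cube y r)))^-1 *
      \1_(cube y r) x * sin (dotv xi x)) mu); last by move=> x _; rewrite /f; simpc.
  apply: cube_average => //.
  + by have [] := bounded_mfun_expi_dotv xi.
  + by move=> x; exact: sin_max.
  + by move=> x yx; apply: le_trans (sin_lipschitz _ _) _; exact: osc.
Qed.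

(** By Euler's formula a cosine combines the exponentials at [y] and [- y], which obey the same
    bound; the phase only contributes constant factors. *)
Lemma fourier_approximable_trig_sum T : trig_sum b T ->
  fourier_approximable (fun xi => (T xi)%:C).
Proof.
elim => [|c y theta {}T yb _ ih]; first exact: fourier_approximable0.
rewrite (_ : (fun _ => _) = fun xi => c%:C *
  ((2^-1)%:C * (expi theta * expi (dotv y xi)) +
   (2^-1)%:C * (expi (- theta) * expi (dotv (- y) xi))) + (T xi)%:C).
  apply: fourier_approximableD ih; apply: fourier_approximableZ.
  by apply: fourier_approximableD; do 2 apply: fourier_approximableZ;
    apply: fourier_approximable_expi => // i; rewrite mxE normrN.
by apply/funext => xi; rewrite dotvNl -cos_expi; simpc.
Qed.

(** Low frequency is invoked at the bound [b], fixed by the radius of the ball. *)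
Lemma fourier_approximable_low_frequency p q :
  low_frequency D p -> low_frequency D q ->
  fourier_approximable (fun xi => p xi +i* q xi).
Proof.
have b0 : 0 < b by rewrite !divr_gt0.
have real p' : low_frequency D p' -> fourier_approximable (fun xi => (p' xi)%:C).
  move=> [_ Vp] e e0; have e2 : 0 < e / 2 by rewrite divr_gt0.
  have [T bT pT] := Vp _ _ b0 e2.
  have [f bf Tf] := fourier_approximable_trig_sum bT e2; exists f => // xi Dxi.
  rewrite -(subrK (T xi)%:C (p' xi)%:C) -addrA (le_trans (le_normcD _ _))//.
  rewrite [leRHS]splitr lerD ?Tf// (_ : _ - _ = (p' xi - T xi)%:C); last by simpc.
  by rewrite normc_real pT.
move=> Vp Vq; rewrite (_ : (fun _ => _) = fun xi => (p xi)%:C + 'i * (q xi)%:C).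
  by apply: fourier_approximableD; [|apply: fourier_approximableZ]; exact: real.
by apply/funext => xi; simpc.
Qed.
End fourier_approximation.

Section integral_monotone.
Import HBNNSimple.

(* Unlike [ge0_le_integral], no measurability is required: the integral of a
   nonnegative function is a supremum over the simple functions below it. *)
Lemma le_integral_of_ge0 d (T : measurableType d) (R : realType)
    (mu : {measure set T -> \bar R}) (D : set T) (f g : T -> \bar R) :
  (forall x, D x -> (0 <= f x)%E) -> (forall x, D x -> (f x <= g x)%E) ->
  (\int[mu]_(x in D) f x <= \int[mu]_(x in D) g x)%E.
Proof.
move=> f0 fg; have g0 x : D x -> (0 <= g x)%E.
  by move=> Dx; exact: le_trans (f0 _ Dx) (fg _ Dx).
rewrite !(integral_mkcond D) !ge0_integralTE; last 2 first.
- by move=> x; exact: erestrict_ge0.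
- by move=> x; exact: erestrict_ge0.
apply: ereal_sup_le => _ [h hf <-]; exists h => // x.
by apply: le_trans (hf x) _; exact: lee_restrict.
Qed.

End integral_monotone.

(** * From density and uniform approximation to the L^2 estimate *)

Local Open Scope complex_scope.

Theorem mainTheorem3 (R : realType) (n : nat) (n_ge1 : (1 <= n)%N)
  (D : set 'rV[R]_n) (domD : domain D) (bndD : bounded_set D)
  (a : R) (a_gt0 : 0 < a)
  (g : 'rV[R]_n -> R[i]) (gL2 : L2 D g)
  (eps : R) (eps_gt0 : 0 < eps) :
  exists f : 'rV[R]_n -> R[i],
    L2 (cball0 a) f /\
    (L2norm D (fun xi => (g xi - fourier_ball a f xi)%R) < eps%:E)%E.
Proof.
have mD : measurable D by case: domD => oD _ _; exact: open_measurable_rV.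
have [M DM] : exists M, forall xi, D xi -> forall i, `|xi ord0 i| <= M.
  have [M0 [_ /(_ _ (ltr_pwDr ltr01 (lexx M0))) DM]] := bndD.
  exists (M0 + 1) => xi Dxi i; apply: le_trans (DM _ Dxi).
  rewrite [leRHS]mx_normrE.
  exact: (le_bigmax _ (fun ij => `|xi ij.1 ij.2|) (ord0, i)).
set mu := lebesgue_rV R n.
have Dfin : (mu D < +oo)%E by exact: bounded_finite_measure DM.
have [mRe mIm gfin] := gL2; move/L2norm_lty in gfin.
(* Reduces complex density to the real theorem: it serves for both the real and the imaginary part
   of [g], each dominated by the modulus. *)
have dense (u : 'rV[R]_n -> R) : measurable_fun D u ->
    (forall x, `|u x| <= normc (g x)) ->
    forall e : R, 0 < e -> exists2 p, low_frequency D p & (sqr_dist mu D u p < e%:E)%E.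
  move=> meu ug.
  have ufin : (\int[mu]_(x in D) (u x ^+ 2)%:E < +oo)%E.
    apply: le_lt_trans gfin; apply: le_integral_of_ge0 => x _.
      by rewrite lee_fin sqr_ge0.
    by rewrite lee_fin -[leLHS]real_normK ?num_real// lerXn2r ?nnegrE ?(le_trans _ (ug x)).
  have Vm p : low_frequency D p -> measurable_fun D p.
    by move=> [mp _]; exact: measurable_funTS.
  by have [_] := L2_dense mD Dfin Vm (low_frequency_cst1 D) (@low_frequencyD _ _ D)
    (@low_frequencyM _ _ D) (@low_frequencyZ _ _ D) (halfspaces_generate DM) meu ufin.
(* The final budget: [2 (eps^2 / 8)] for each of the two parts of [g] and [2 eta^2 m <= eps^2 / 8]
   for the uniform error, in all less than [eps^2]. *)
have s0 : 0 < eps ^+ 2 / 8 by rewrite divr_gt0// exprn_gt0.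
have [p Vp up] := dense _ mRe (fun x => normc_Re (g x)) _ s0.
have [q Vq vq] := dense _ mIm (fun x => normc_Im (g x)) _ s0.
pose m := fine (mu D).
have m0 : 0 <= m by exact: fine_ge0.
(* The factor [m + 1] is positive even if [m = 0], and [m <= (m + 1)^2] yields
   [eta^2 m <= eps^2 / 16]. *)
pose eta := eps / (4 * (m + 1)).
have eta0 : 0 < eta by rewrite divr_gt0// mulr_gt0// ltr_wpDl.
have etam : eta ^+ 2 * m <= eps ^+ 2 / 16.
  rewrite expr_div_n exprMn -mulrA ler_wpM2l ?sqr_ge0//.
  rewrite ler_pdivrMl; last by rewrite mulr_gt0// exprn_gt0// ltr_wpDl.
  rewrite (_ : _ * _ = (m + 1) ^+ 2); last by field.
  by rewrite expr2; nra.
have [f bf fpq] := fourier_approximable_low_frequency a_gt0 DM Vp Vq eta0.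
exists f; split; first exact: bounded_mfun_L2.
apply: L2norm_lt => //.
have [[mp _] [mq _]] := (Vp, Vq).
have mDp := measurable_funTS (D := D) mp.
have mDq := measurable_funTS (D := D) mq.
(* A measurable majorant of the squared error, from [|g - w| + eta] with [w = p + i q]. Comparing
   through [le_integral_of_ge0] avoids proving that the Fourier transform is measurable in [xi]. *)
pose F x : \bar R := (2%:E * ((complex.Re (g x) - p x) ^+ 2)%:E +
  2%:E * ((complex.Im (g x) - q x) ^+ 2)%:E + (2 * eta ^+ 2)%:E)%E.
apply: (@le_lt_trans _ _ (\int[mu]_(x in D) F x)%E).
  apply: le_integral_of_ge0 => x Dx; first by rewrite lee_fin sqr_ge0.
  rewrite /F -!EFinM -!EFinD lee_fin.
  set w := p x +i* q x.
  have := fpq _ Dx; rewrite -/w => wf.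
  have tri : normc (g x - fourier_ball a f x) <= normc (g x - w) + eta.
    by rewrite -(subrK w (g x)) -addrA (le_trans (le_normcD _ _))// subrK lerD2l.
  have n0 z : 0 <= normc z :> R by case: z => s t; exact: sqrtr_ge0.
  apply: (@le_trans _ _ ((normc (g x - w) + eta) ^+ 2)).
    by rewrite lerXn2r ?nnegrE// addr_ge0// ltW.
  have -> : complex.Re (g x) - p x = complex.Re (g x - w) by case: (g x).
  have -> : complex.Im (g x) - q x = complex.Im (g x - w) by case: (g x).
  rewrite -mulrDr -sqr_normc.
  by have := sqr_ge0 (normc (g x - w) - eta); rewrite !expr2; nra.
have m1 := sqr_dist_measurable mRe mDp.
have m2 := sqr_dist_measurable mIm mDq.
rewrite /F ge0_integralD//; last 3 first.
- by move=> x _; rewrite -!EFinM -EFinD lee_fin addr_ge0// mulr_ge0// sqr_ge0.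
- by apply: emeasurable_funD; exact: emeasurable_funM.
- by move=> x _; rewrite lee_fin mulr_ge0// sqr_ge0.
rewrite ge0_integralD//; last 4 first.
- by move=> x _; rewrite -EFinM lee_fin mulr_ge0// sqr_ge0.
- exact: emeasurable_funM.
- by move=> x _; rewrite -EFinM lee_fin mulr_ge0// sqr_ge0.
- exact: emeasurable_funM.
rewrite !ge0_integralZl//; try by move=> x _; rewrite lee_fin sqr_ge0.
have -> : (\int[mu]_(x in D) (2 * eta ^+ 2)%:E = (2 * (eta ^+ 2 * m))%:E)%E.
  by rewrite integral_cst// mulrA [RHS]EFinM /m fineK// ge0_fin_numE.
have sqr_dist_ge0 (u v : 'rV[R]_n -> R) : (0 <= sqr_dist mu D u v)%E.
  by apply: integral_ge0 => x _; rewrite lee_fin sqr_ge0.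
rewrite -/(sqr_dist mu D (fun x => complex.Re (g x)) p).
rewrite -/(sqr_dist mu D (fun x => complex.Im (g x)) q).
move: up vq (sqr_dist_ge0 (fun x => complex.Re (g x)) p).
move: (sqr_dist_ge0 (fun x => complex.Im (g x)) q).
case: (sqr_dist _ _ _ p) => // r; case: (sqr_dist _ _ _ q) => // t.
rewrite -!EFinM -!EFinD !lte_fin !lee_fin; lra.
Qed.
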